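(* Let $a,b>0$ be real numbers with $a^2=b^2+1$. Consider the ellipse $\frac{x^2}{a^2}+\frac{y^2}{b^2}=1$, with eccentricity $e_1=\frac{1}{a}$, and the hyperbola $x^2-\frac{y^2}{b^2}=1$, with eccentricity $e_2=a$. Let $O=(0,0)$, $F_2=(1,0)$, $K=(0,b)$, $N=(a,0)$. Let $P$ be the intersection point of the ellipse and the hyperbola that lies in the open first quadrant, let $Q$ be the foot of the perpendicular from $P$ to the line $ON$ (the $x$-axis), and let $H=\left(\frac{1}{a},0\right)$ be the intersection of $ON$ with the right directrix $x=\frac1a$ of the hyperbola. If the line $PN$ is parallel to the line $KF_2$, then $$e_1=\frac{1}{\phi\sqrt{\phi}},\qquad e_2=\phi\sqrt{\phi},\qquad \frac{ON}{OQ}=\frac{OQ}{HQ}=\phi,$$ where $\phi=\frac{1+\sqrt5}{2}$; in other words, $Q$ divides $ON$ into the golden ratio and $H$ divides $OQ$ into the golden ratio.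
   Context: $XY$ denotes the length of the segment with endpoints $X$ and $Y$. The configuration is an ellipse $\frac{x^2}{a^2}+\frac{y^2}{b^2}=1$ and a hyperbola $\frac{x^2}{c^2}-\frac{y^2}{b^2}=1$ with $a^2=b^2+c^2$, normalized so that $c=OF_2=1$; thus $a>1$, $e_1e_2=1$, and the foci $(\pm1,0)$ of the ellipse are the vertices of the hyperbola. A point $X$ of a segment $YZ$ divides it into the golden ratio if the ratio of the whole segment to the larger part equals $\phi$. *)

(* Defs.v *)
From Stdlib Require Import Reals Lra.
Open Scope R_scope.

Definition point : Type := (R * R)%type.

Definition phi : R := (1 + sqrt 5) / 2.

Definition len (X Y : point) : R := dist_euc (fst X) (snd X) (fst Y) (snd Y).

Definition ellipse (a b : R) (X : point) : Prop :=
  fst X ^ 2 / a ^ 2 + snd X ^ 2 / b ^ 2 = 1.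

Definition hyperbola (a b : R) (X : point) : Prop :=
  fst X ^ 2 / a ^ 2 - snd X ^ 2 / b ^ 2 = 1.

(* Linear eccentricity over semi-major axis, for 0 < b <= a. *)
Definition ellipse_eccentricity (a b : R) : R := sqrt (a ^ 2 - b ^ 2) / a.

Definition hyperbola_eccentricity (a b : R) : R := sqrt (a ^ 2 + b ^ 2) / a.

Definition right_directrix (a b : R) (X : point) : Prop :=
  fst X = a / hyperbola_eccentricity a b.

Definition on_line (Y Z X : point) : Prop :=
  exists t : R, X = (fst Y + t * (fst Z - fst Y), snd Y + t * (snd Z - snd Y)).

Definition on_segment (Y Z X : point) : Prop :=
  exists t : R, 0 <= t <= 1 /\
    X = (fst Y + t * (fst Z - fst Y), snd Y + t * (snd Z - snd Y)).

(* Proportional direction vectors, for X <> Y and Z <> W; coincident lines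
   count as parallel. *)
Definition parallel (X Y Z W : point) : Prop :=
  exists k : R, k <> 0 /\
    fst Y - fst X = k * (fst W - fst Z) /\ snd Y - snd X = k * (snd W - snd Z).

Definition foot_of_perpendicular (P Y Z Q : point) : Prop :=
  on_line Y Z Q /\
  (fst P - fst Q) * (fst Z - fst Y) + (snd P - snd Q) * (snd Z - snd Y) = 0.

Definition divides_golden (X Y Z : point) : Prop :=
  on_segment Y Z X /\ len Y Z / Rmax (len Y X) (len X Z) = phi.

Lemma ellipse_eccentricity_normalized (a b : R) :
  a ^ 2 = b ^ 2 + 1 -> ellipse_eccentricity a b = 1 / a.
Proof.
intros h; unfold ellipse_eccentricity.
replace (a ^ 2 - b ^ 2) with 1 by lra; now rewrite sqrt_1.
Qed.

Lemma hyperbola_eccentricity_normalized (a b : R) :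
  0 < a -> a ^ 2 = b ^ 2 + 1 -> hyperbola_eccentricity 1 b = a.
Proof.
intros ha h; unfold hyperbola_eccentricity.
replace (1 ^ 2 + b ^ 2) with (a ^ 2) by lra.
rewrite sqrt_pow2; lra.
Qed.

Lemma right_directrix_meets_axis (a b : R) (H : point) :
  0 < a -> a ^ 2 = b ^ 2 + 1 ->
  (on_line (0, 0) (a, 0) H /\ right_directrix 1 b H) <-> H = (1 / a, 0).
Proof.
intros ha h; unfold right_directrix.
rewrite (hyperbola_eccentricity_normalized a b ha h); split.
- intros [[t ->] e]; simpl in *; f_equal; [exact e | ring].
- intros ->; split; [| reflexivity].
  exists (1 / a ^ 2); simpl; f_equal; field; lra.
Qed.

(* Main.v *)
(** The equation of the hyperbola and the direction of [PN] force
    the abscissa of [P] to be [(a^2 + 1) / (2 a)], while adding the two conic equations gives its square as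
    [2 a^2 / (a^2 + 1)]. Comparing, [u = a^2] satisfies
    [(u - 1) (u^2 - 4 u - 1) = 0], and [u > 1] leaves [u = 2 + sqrt 5 = phi^3].
    With [s = sqrt phi] the points of the axis are then [N = phi s], [Q = s] and
    [H = (2 - phi) s], and everything follows from [phi^2 = phi + 1]. *)
Require Import Defs.
From Stdlib Require Import Reals Lra.
Open Scope R_scope.

Lemma phi_square : phi ^ 2 = phi + 1.
Proof.
unfold phi; pose proof (pow2_sqrt 5 ltac:(lra)); nra.
Qed.

(** The bound 3/2 is what makes [HQ] longer than [OH], since [phi - 1 > 2 - phi]; the bound 2 makes
    [OQ] longer than [QN] and keeps [H] to the right of [O]. *)
Lemma phi_bounds : 3 / 2 < phi < 2.
Proof.
unfold phi; pose proof (pow2_sqrt 5 ltac:(lra)); pose proof (sqrt_pos 5); nra.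
Qed.

Lemma len_axis (x y : R) : x <= y -> len (x, 0) (y, 0) = y - x.
Proof.
intros hxy; unfold len, dist_euc; simpl.
replace (Rsqr (x - y) + Rsqr (0 - 0)) with (Rsqr (y - x)) by (unfold Rsqr; ring).
apply sqrt_Rsqr; lra.
Qed.

Lemma on_segment_axis (x y : R) :
  0 <= x <= y -> 0 < y -> on_segment (0, 0) (y, 0) (x, 0).
Proof.
intros hx hy; exists (x / y); split.
- split.
  + apply Rmult_le_pos; [lra | apply Rlt_le, Rinv_0_lt_compat, hy].
  + apply Rmult_le_reg_r with y; [exact hy |].
    replace (x / y * y) with x by (field; lra); lra.
- simpl; f_equal; field; lra.
Qed.

Lemma foot_on_axis (P Q : point) (a : R) :
  a <> 0 -> foot_of_perpendicular P (0, 0) (a, 0) Q -> Q = (fst P, 0).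
Proof.
intros ha [[t ->] h]; simpl in *; f_equal; [| ring].
apply Rmult_eq_reg_r with a; [lra | exact ha].
Qed.

Section ParallelConfiguration.

Variables (a b p q : R).
Hypotheses (ha : 0 < a) (hb : 0 < b) (hab : a ^ 2 = b ^ 2 + 1).
Hypotheses (hE : ellipse a b (p, q)) (hH : hyperbola 1 b (p, q)).
Hypothesis hpar : parallel (p, q) (a, 0) (0, b) (1, 0).

Lemma hyperbola_ordinate : q ^ 2 = b ^ 2 * (p ^ 2 - 1).
Proof.
unfold hyperbola in hH; simpl fst in hH; simpl snd in hH.
replace (p ^ 2 - 1) with (q ^ 2 / b ^ 2) by lra.
field; lra.
Qed.

Lemma intersection_abscissa_square : p ^ 2 * (a ^ 2 + 1) = 2 * a ^ 2.
Proof.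
unfold ellipse in hE; unfold hyperbola in hH; simpl fst in *; simpl snd in *.
replace (p ^ 2 * (a ^ 2 + 1)) with (a ^ 2 * (p ^ 2 / a ^ 2 + p ^ 2 / 1 ^ 2))
  by (field; lra).
replace (p ^ 2 / a ^ 2 + p ^ 2 / 1 ^ 2) with 2 by lra; ring.
Qed.

Lemma parallel_abscissa : 2 * a * p = a ^ 2 + 1.
Proof.
destruct hpar as [k [_ [e1 e2]]]; simpl in e1, e2.
(* The direction from [K] to [F2] is [(1, -b)], so [k = a - p]. Substituting in the hyperbola
   cancels the [p ^ 2] terms and leaves a linear equation. *)
assert (hq : q = b * (a - p)) by (rewrite e1; lra).
pose proof hyperbola_ordinate as h; rewrite hq in h.
apply Rmult_eq_reg_l with (b ^ 2); [lra | apply pow_nonzero; lra].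
Qed.

Lemma square_semi_axis : a ^ 2 = 2 * phi + 1.
Proof.
pose proof intersection_abscissa_square as hp.
pose proof parallel_abscissa as h.
pose proof phi_square as h2; pose proof phi_bounds.
assert (hu : 1 < a ^ 2) by (rewrite hab; pose proof (pow_lt b 2 hb); lra).
(* Eliminates [p]: square [2 * a * p = a ^ 2 + 1], multiply by [a ^ 2 + 1], and use [hp]. *)
assert (hc : (a ^ 2 + 1) ^ 3 = 8 * (a ^ 2) ^ 2).
{ replace ((a ^ 2 + 1) ^ 3) with ((2 * a * p) ^ 2 * (a ^ 2 + 1))
    by (rewrite h; ring).
  replace ((2 * a * p) ^ 2 * (a ^ 2 + 1))
    with (4 * a ^ 2 * (p ^ 2 * (a ^ 2 + 1))) by ring.
  rewrite hp; ring. }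
set (u := a ^ 2) in *; clearbody u.
(* The roots [2 + sqrt 5] and [2 - sqrt 5] of the quadratic factor, written in terms of [phi]; the
   second is negative. *)
assert (hr : (u - 1) * ((u - (2 * phi + 1)) * (u - (3 - 2 * phi))) = 0).
{ replace ((u - (2 * phi + 1)) * (u - (3 - 2 * phi)))
    with (u ^ 2 - 4 * u + 3 - 4 * (phi ^ 2 - phi)) by ring.
  rewrite h2; lra. }
apply Rmult_integral in hr; destruct hr as [hr | hr]; [lra |].
apply Rmult_integral in hr; lra.
Qed.

Lemma semi_axis : a = phi * sqrt phi.
Proof.
pose proof square_semi_axis; pose proof phi_square as h2; pose proof phi_bounds.
assert (hs : 0 < sqrt phi) by (apply sqrt_lt_R0; lra).
assert (hs2 : sqrt phi ^ 2 = phi) by (apply pow2_sqrt; lra).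
apply Rsqr_inj; [lra | nra |].
rewrite !Rsqr_pow2, Rpow_mult_distr, hs2, h2; lra.
Qed.

(** Here [2 * a * p = 2 * phi + 2 = 2 * phi ^ 2], and dividing by [2 * a = 2 * phi * sqrt phi]
    leaves [sqrt phi]. *)
Lemma abscissa : p = sqrt phi.
Proof.
pose proof parallel_abscissa as h; pose proof square_semi_axis as ha2.
pose proof phi_square; pose proof phi_bounds.
assert (hs2 : sqrt phi ^ 2 = phi) by (apply pow2_sqrt; lra).
apply Rmult_eq_reg_l with (2 * a); [| lra].
rewrite h, ha2, semi_axis.
replace (2 * (phi * sqrt phi) * sqrt phi) with (2 * phi * sqrt phi ^ 2) by ring.
rewrite hs2; lra.
Qed.

End ParallelConfiguration.

(** Holds because [(2 - phi) * phi ^ 2 = 1]. It puts [H] on the same scale [sqrt phi] as [N] and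
    [Q]. *)
Lemma inv_phi_sqrt_phi : 1 / (phi * sqrt phi) = (2 - phi) * sqrt phi.
Proof.
pose proof phi_square; pose proof phi_bounds.
assert (hs : 0 < sqrt phi) by (apply sqrt_lt_R0; lra).
assert (hs2 : sqrt phi ^ 2 = phi) by (apply pow2_sqrt; lra).
apply Rmult_eq_reg_r with (phi * sqrt phi); [| nra].
replace (1 / (phi * sqrt phi) * (phi * sqrt phi)) with 1 by (field; lra).
replace ((2 - phi) * sqrt phi * (phi * sqrt phi))
  with ((2 - phi) * phi * sqrt phi ^ 2) by ring.
rewrite hs2; nra.
Qed.

Theorem proposition2p2 (a b : R) (O F2 K N P Q H : point)
  (ha : 0 < a) (hb : 0 < b) (hab : a ^ 2 = b ^ 2 + 1)
  (hO : O = (0, 0)) (hF2 : F2 = (1, 0)) (hK : K = (0, b)) (hN : N = (a, 0))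
  (hPE : ellipse a b P) (hPH : hyperbola 1 b P)
  (hPx : 0 < fst P) (hPy : 0 < snd P)
  (hQ : foot_of_perpendicular P O N Q)
  (hHl : on_line O N H) (hHd : right_directrix 1 b H)
  (hpar : parallel P N K F2) :
  ellipse_eccentricity a b = 1 / (phi * sqrt phi) /\
  hyperbola_eccentricity 1 b = phi * sqrt phi /\
  len O N / len O Q = len O Q / len H Q /\
  len O Q / len H Q = phi /\
  divides_golden Q O N /\
  divides_golden H O Q.
Proof.
subst O F2 K N; destruct P as [p q]; simpl fst in hPx.
apply foot_on_axis in hQ; [| lra]; simpl fst in hQ.
pose proof (semi_axis a b p q ha hb hab hPE hPH hpar) as ea.
pose proof (abscissa a b p q ha hb hab hPE hPH hpar) as ep.
assert (eH : H = (1 / a, 0))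
  by (apply (right_directrix_meets_axis a b); auto).
rewrite ellipse_eccentricity_normalized by exact hab.
rewrite (hyperbola_eccentricity_normalized a b) by assumption.
rewrite ea, inv_phi_sqrt_phi in eH.
subst Q H; rewrite ep, ea.
pose proof phi_square as h2; pose proof phi_bounds.
assert (hs : 0 < sqrt phi) by (apply sqrt_lt_R0; lra).
(* Every length below is [s] times a polynomial in [phi] of degree at most 1, so only [0 < s]
   matters for the ratios. *)
set (s := sqrt phi) in *; clearbody s.
assert (eON : len (0, 0) (phi * s, 0) = phi * s)
  by (rewrite len_axis; nra).
assert (eOQ : len (0, 0) (s, 0) = s) by (rewrite len_axis; lra).
assert (eQN : len (s, 0) (phi * s, 0) = (phi - 1) * s)
  by (rewrite len_axis; nra).
assert (eOH : len (0, 0) ((2 - phi) * s, 0) = (2 - phi) * s)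
  by (rewrite len_axis; nra).
assert (eHQ : len ((2 - phi) * s, 0) (s, 0) = (phi - 1) * s)
  by (rewrite len_axis; nra).
assert (r1 : phi * s / s = phi) by (field; lra).
assert (r2 : s / ((phi - 1) * s) = phi).
{ replace (s / ((phi - 1) * s)) with (1 / (phi - 1)) by (field; lra).
  apply Rmult_eq_reg_r with (phi - 1); [| lra].
  replace (1 / (phi - 1) * (phi - 1)) with 1 by (field; lra); lra. }
unfold divides_golden; rewrite eON, eOQ, eQN, eOH, eHQ.
(* The larger part is [OQ] in the division of [ON], but [HQ] in that of [OQ]. *)
rewrite Rmax_left by nra; rewrite Rmax_right by nra.
repeat split; try lra; apply on_segment_axis; nra.
Qed.
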